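(* Let $\mathfrak{A}$ be a $C^*$-algebra, let $T$ be a locally compact Hausdorff space equipped with a (Radon) probability measure $P$, and let $(A_t)_{t\in T}$ be a continuous field of operators in $\mathfrak{A}$ such that the function $t\mapsto A_t$ is norm continuous on $T$ and the function $t\mapsto \|A_t\|$ is integrable. Then $$\int_T\left|A_t-\int_T A_s\,\mathrm{d}P(s)\right|^2\mathrm{d}P(t)=\int_T|A_t|^2\,\mathrm{d}P(t)-\left|\int_T A_t\,\mathrm{d}P(t)\right|^2 .$$
   Context: A field $(A_t)_{t\in T}$ of operators in a $C^*$-algebra $\mathfrak{A}$, indexed by a locally compact Hausdorff space $T$, is called a continuous field of operators if the function $t\mapsto A_t$ is norm continuous on $T$. For an element $A$ of $\mathfrak{A}$, $|A|=(A^*A)^{1/2}$, so $|A|^2=A^*A$. Integrals of $\mathfrak{A}$-valued functions are Bochner integrals: if $\mu$ is a Radon measure on $T$ and the function $t\mapsto\|A_t\|$ is integrable, then $\int_T A_t\,\mathrm{d}\mu(t)$ is the unique element of $\mathfrak{A}$ such that $\varphi\left(\int_T A_t\,\mathrm{d}\mu(t)\right)=\int_T\varphi(A_t)\,\mathrm{d}\mu(t)$ for every linear functional $\varphi$ in the norm dual $\mathfrak{A}^*$ of $\mathfrak{A}$.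
   Formalization: The formal theorem additionally assumes that the function t ↦ ‖|A_t|²‖ is integrable; without this the integral of |A_t|² need not exist (e.g. A_t = t^{-1/2} on (0,1) with Lebesgue measure). *)

(* Defs.v *)
From HB Require Import structures.
From mathcomp Require Import all_boot all_order all_algebra.
From mathcomp Require Import complex.
From mathcomp Require Import all_classical all_reals all_analysis.

Set Implicit Arguments.
Unset Strict Implicit.
Unset Printing Implicit Defensive.

Import Order.TTheory GRing.Theory Num.Theory.
Import numFieldNormedType.Exports.

Local Open Scope classical_set_scope.
Local Open Scope ring_scope.
Local Open Scope complex_scope.

(* Complex C*-algebras, not assumed to be unital.  MathComp rings all have a
   unit, so the product is part of the structure.  The norm takes its values
   in R[i], as for every normedModType over R[i]. *)
HB.mixin Record CompleteNormedModule_isCStarAlgebra (R : realType) V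
    & CompleteNormedModule R[i] V := {
  csmul : V -> V -> V ;
  csstar : V -> V ;
  csmulA : associative csmul ;
  csmulDl : left_distributive csmul +%R ;
  csmulDr : right_distributive csmul +%R ;
  csscaleAl : forall (k : R[i]) (a b : V),
    k *: csmul a b = csmul (k *: a) b ;
  csscaleAr : forall (k : R[i]) (a b : V),
    k *: csmul a b = csmul a (k *: b) ;
  csstarK : involutive csstar ;
  csstarD : {morph csstar : a b / a + b} ;
  csstarZ : forall (k : R[i]) (a : V),
    csstar (k *: a) = conjc k *: csstar a ;
  csstarM : forall a b : V, csstar (csmul a b) = csmul (csstar b) (csstar a) ;
  csnormM : forall a b : V, `|csmul a b| <= `|a| * `|b| ;
  csnorm_star : forall a : V, `|csmul (csstar a) a| = `|a| ^+ 2
}.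

#[short(type="cstarAlgType")]
HB.structure Definition CStarAlgebra (R : realType) :=
  {V of CompleteNormedModule R[i] V & CompleteNormedModule_isCStarAlgebra R V}.

Section modulus.
Context {R : realType} {V : cstarAlgType R}.
Implicit Types a b c : V.

Definition cssqr a : V := csmul a a.

(* Positive elements are those of the form c^* c, which avoids spectra in a
   possibly non-unital algebra. *)
Definition cspos a : Prop := exists c, a = csmul (csstar c) c.

(* The positive square root (junk value 0 when there is none, i.e. when the
   argument is not positive). *)
Definition cssqrt a : V := xget 0 [set b | cspos b /\ cssqr b = a].

Definition csabs a : V := cssqrt (csmul (csstar a) a).

End modulus.

Notation borel T := (g_sigma_algebraType (@open T)).

(* Regularity is required on all Borel sets.  For finite measures on a locally
   compact Hausdorff space this is equivalent to the definition by outer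
   regularity on Borel sets and inner regularity on open sets. *)
Definition radon (R : realType) (T : ptopologicalType)
    (mu : {measure set (borel T) -> \bar R}) : Prop :=
  (forall K : set T, compact K -> (mu K < +oo)%E) /\
  (forall B : set (borel T), measurable B ->
     mu B = ereal_sup [set mu K | K in [set K : set T | compact K /\ K `<=` B]]).

Section integral.
Context {d : measure_display} {X : measurableType d} {R : realType}.
Variable mu : {measure set X -> \bar R}.

Definition cintegrable (f : X -> R[i]) : Prop :=
  mu.-integrable setT (fun x => (complex.Re (f x))%:E) /\
  mu.-integrable setT (fun x => (complex.Im (f x))%:E).

Definition cintegral (f : X -> R[i]) : R[i] :=
  (\int[mu]_(x in setT) complex.Re (f x)) +i*
  (\int[mu]_(x in setT) complex.Im (f x)).

Context {V : completeNormedModType R[i]}.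

(* complex.Re only casts the norm, a nonnegative real of R[i], to R. *)
Definition norm_integrable (f : X -> V) : Prop :=
  mu.-integrable setT (fun x => (complex.Re `|f x|)%:E).

Definition is_bochner (f : X -> V) (v : V) : Prop :=
  norm_integrable f /\
  forall phi : {linear V -> R[i]^o}, continuous phi ->
    cintegrable (phi \o f) /\ phi v = cintegral (phi \o f).

(* Junk value 0 when f has no integral. *)
Definition bochner (f : X -> V) : V := xget 0 [set v | is_bochner f v].

End integral.

(* Main.v *)
Require Import Defs.
From HB Require Import structures.
From mathcomp Require Import all_boot all_order all_algebra.
From mathcomp Require Import complex.
From mathcomp Require Import all_classical all_reals all_analysis.
From mathcomp Require Import measurable_realfun ring lra.

(** The algebra is bilinearity: expanding [(A_t - m)^* (A_t - m)] and pairing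
    with a real-linear functional [q] reduces the identity to
    [\int q (m^* A_t + A_t^* m) = 2 q (m^* m)].  Three facts make it legitimate.

    [|a|^2 = a^* a], i.e. [a^* a] has a positive square root.  Call a self-adjoint
    [h] nonnegative when [|M - h| <= M] for some [M > 0], the norm being that of
    operators on the algebra; such elements form a convex cone and have square
    roots, by the Newton-like iteration [r' = (u + r^2) / 2].  Squares [h^2] are
    nonnegative because [h + i sqrt (1 - h^2)] is unitary.  Then Kelley and
    Vaught's argument applies: if [n = sqrt (h^2) - h] with [h = a^* a] and
    [b = a n], then [- b^* b] is a square, hence so is nonnegative [b b^*], hence
    [b^* b] as well, so that [b = 0] and [h = sqrt (h^2)].

    Functionals norm the space (Hahn-Banach): a minimal sublinear functional is
    linear.

    A norm-integrable continuous field has an integral: by tightness of [P] it is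
    close to a simple function off a small set, and the integrals of these simple
    functions are Cauchy since functionals norm the space. *)

Set Implicit Arguments.
Unset Strict Implicit.
Unset Printing Implicit Defensive.

Import Order.TTheory GRing.Theory Num.Theory.
Import numFieldNormedType.Exports.
Local Open Scope classical_set_scope.
Local Open Scope ring_scope.
Local Open Scope complex_scope.

(** * Linear identities in a module *)

(* [ring] does not see modules: [lmod_start] reduces an equation between linear
   combinations to equations between the coefficients of each atom. *)
Section lmodule_reflection.
Context {K : comNzRingType} {V : lmodType K}.

Inductive lexp : Type :=
  | LVar of nat | LZero | LAdd of lexp & lexp | LOpp of lexp
  | LScale of K & lexp.

Fixpoint leval (env : seq V) (e : lexp) : V :=
  match e with
  | LVar i => nth 0 env i
  | LZero => 0
  | LAdd e1 e2 => leval env e1 + leval env e2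
  | LOpp e1 => - leval env e1
  | LScale k e1 => k *: leval env e1
  end.

Fixpoint lcoef (e : lexp) (i : nat) : K :=
  match e with
  | LVar j => if eqn j i then 1 else 0
  | LZero => 0
  | LAdd e1 e2 => lcoef e1 i + lcoef e2 i
  | LOpp e1 => - lcoef e1 i
  | LScale k e1 => k * lcoef e1 i
  end.

(** A conjunction by recursion rather than a quantified statement, so that simplification over a
    literal list of atoms leaves one scalar goal per atom for [ring]. *)
Fixpoint lcoef_eq (e1 e2 : lexp) (n : nat) : Prop :=
  match n with
  | 0 => True
  | m.+1 => lcoef e1 m = lcoef e2 m /\ lcoef_eq e1 e2 m
  end.

Lemma leval_sum env e :
  leval env e = \sum_(i < size env) lcoef e i *: nth 0 env i.
Proof.
elim: e => [j||e1 IH1 e2 IH2|e1 IH|k e1 IH] /=.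
- have [jlt|jge] := ltnP j (size env); last first.
    rewrite nth_default// big1// => i _.
    by rewrite -[eqn j i]/(j == i :> nat) gtn_eqF ?scale0r// (leq_trans (ltn_ord i)).
  rewrite (bigD1 (Ordinal jlt))//= -[eqn j j]/(j == j) eqxx scale1r big1 ?addr0// => i ij.
  by rewrite -[eqn j i]/(j == i :> nat) eq_sym (negbTE (_ : i != j :> nat)) ?scale0r.
- by rewrite big1// => i _; rewrite scale0r.
- by rewrite IH1 IH2 -big_split/=; apply: eq_bigr => i _; rewrite scalerDl.
- by rewrite IH -sumrN; apply: eq_bigr => i _; rewrite scaleNr.
- by rewrite IH scaler_sumr; apply: eq_bigr => i _; rewrite scalerA.
Qed.

Lemma leval_eq env e1 e2 :
  lcoef_eq e1 e2 (size env) -> leval env e1 = leval env e2.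
Proof.
rewrite !leval_sum => H; apply: eq_bigr => -[i ilt] _ /=; congr (_ *: _).
elim: (size env) ilt H => //= n IH; rewrite ltnS leq_eqVlt.
by move=> /predU1P[-> []//|] /IH{}IH [_ /IH].
Qed.

End lmodule_reflection.

Ltac lmod_pos env t n :=
  lazymatch env with
  | t :: _ => constr:(n)
  | _ :: ?env' => lmod_pos env' t (S n)
  end.

Ltac lmod_add env t :=
  let rec mem e := lazymatch e with
    | t :: _ => constr:(env)
    | _ :: ?e' => mem e'
    | nil => constr:(t :: env)
    end in mem env.

Ltac lmod_atoms env t :=
  lazymatch t with
  | @GRing.add _ ?a ?b => let env1 := lmod_atoms env a in lmod_atoms env1 b
  | @GRing.opp _ ?a => lmod_atoms env a
  | @GRing.scale _ _ _ ?a => lmod_atoms env a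
  | @GRing.zero _ => constr:(env)
  | _ => lmod_add env t
  end.

Ltac lmod_reify K env t :=
  lazymatch t with
  | @GRing.add _ ?a ?b =>
      let ea := lmod_reify K env a in let eb := lmod_reify K env b in
      constr:(@LAdd K ea eb)
  | @GRing.opp _ ?a => let ea := lmod_reify K env a in constr:(@LOpp K ea)
  | @GRing.scale _ _ ?k ?a =>
      let ea := lmod_reify K env a in constr:(@LScale K k ea)
  | @GRing.zero _ => constr:(@LZero K)
  | _ => let n := lmod_pos env t 0%N in constr:(@LVar K n)
  end.

Ltac lmod_start K V :=
  lazymatch goal with
  | |- @eq _ ?a ?b =>
      let env0 := lmod_atoms (@nil V) a in
      let env := lmod_atoms env0 b in
      let ea := lmod_reify K env a in
      let eb := lmod_reify K env b in
      apply: (@leval_eq K V env ea eb); rewrite /=;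
      repeat (split; [ | ]); try exact: Logic.I
  end.

(** * Real-valued norms *)

Section real_norm.
Context {R : realType} {W : normedModType R[i]}.
Implicit Types v w : W.

Definition rnorm v : R := complex.Re `|v|.

Lemma normE v : `|v| = (rnorm v)%:C.
Proof. by rewrite /rnorm RRe_real. Qed.

Lemma rnorm_ge0 v : 0 <= rnorm v.
Proof. by rewrite -lecR -normE normr_ge0. Qed.

Lemma rnormN v : rnorm (- v) = rnorm v.
Proof. by rewrite /rnorm normrN. Qed.

Lemma rnorm0 : rnorm (0 : W) = 0.
Proof. by rewrite /rnorm normr0. Qed.

Lemma rnorm_eq0 v : rnorm v = 0 -> v = 0.
Proof. by move=> v0; apply/eqP; rewrite -normr_eq0 normE v0. Qed.

Lemma ler_rnormD v w : rnorm (v + w) <= rnorm v + rnorm w.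
Proof. by rewrite -lecR rmorphD/= -!normE ler_normD. Qed.

Lemma ler_rnormB v w : rnorm (v - w) <= rnorm v + rnorm w.
Proof. by rewrite -(rnormN w) ler_rnormD. Qed.

End real_norm.

Section real_norm_scale.
Context {R : realType} {W : normedModType R[i]}.
Implicit Types v w : W.

Lemma rnormZ (k : R[i]) v : rnorm (k *: v) = rnorm (k : R[i]^o) * rnorm v.
Proof. by apply: complexI; rewrite rmorphM/= -!normE normrZ. Qed.

Lemma rnormR (r : R) : rnorm (r%:C : R[i]^o) = `|r|.
Proof. by apply: complexI; rewrite -normE normc_def/= expr0n/= addr0 sqrtr_sqr. Qed.

Lemma rnorm_i : rnorm ('i : R[i]^o) = 1.
Proof.
by apply: complexI; rewrite -normE normc_def/= expr0n/= expr1n add0r sqrtr1.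
Qed.

Lemma rnormZR (r : R) v : rnorm (r%:C *: v) = `|r| * rnorm v.
Proof. by rewrite rnormZ rnormR. Qed.

Lemma rnormZi v : rnorm ('i *: v) = rnorm v.
Proof. by rewrite rnormZ rnorm_i mul1r. Qed.

Lemma ler_Re_rnorm (k : R[i]) : `|complex.Re k| <= rnorm (k : R[i]^o).
Proof. by rewrite -lecR -normE normc_ge_Re. Qed.

End real_norm_scale.

(** * Limits of sequences with an explicit $C/(n+1)$ rate *)

Section harmonic_convergence.
Context {R : realType} {W : completeNormedModType R[i]}.

Lemma le_harmonic_le0 (a C : R) : (forall n, a <= C / n.+1%:R) -> a <= 0.
Proof.
move=> aC; rewrite leNgt; apply/negP => a0.
have C0 : 0 < C by have := aC 0%N; rewrite divr1; apply: lt_le_trans.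
have [n Cn] : exists n : nat, C / a < n%:R.
  by exists (Num.truncn (C / a)).+1; apply: truncnS_gt.
have := aC n; apply/negP; rewrite -ltNge ltr_pdivrMr// mulrC -ltr_pdivrMr//.
by rewrite (lt_le_trans Cn)// ler_nat.
Qed.

Lemma harmonic_cauchy_lim (u : nat -> W) (C : R) :
  (forall n m, (n <= m)%N -> rnorm (u m - u n) <= C / n.+1%:R) ->
  exists l, forall n, rnorm (u n - l) <= C / n.+1%:R.
Proof.
move=> uC.
have C0 : 0 <= C by have := uC 0 0 (leqnn 0); rewrite subrr rnorm0 divr1.
have small (e : R) : 0 < e -> \forall n \near \oo, C / n.+1%:R < e.
  move=> e0; near=> n; rewrite ltr_pdivrMr// mulrC -ltr_pdivrMr//.
  apply: (lt_le_trans (truncnS_gt _)); rewrite ler_nat ltnW// ltnS.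
  by near: n; exact: nbhs_infty_gt.
have /cauchy_cvgP ucvg : cauchy (u @ \oo).
  apply/cauchy_ballP => e e0.
  have eE : e = (complex.Re e)%:C by rewrite RRe_real// gtr0_real.
  have Re0 : 0 < complex.Re e by rewrite -ltcR -eE.
  have [n _ nP] := small _ (divr_gt0 Re0 (ltr0Sn R 1)).
  have un m : (n <= m)%N -> rnorm (u m - u n) < complex.Re e / 2.
    by move=> nm; rewrite (le_lt_trans (uC _ _ nm))// nP/=.
  pose S := [set y | rnorm (y - u n) < complex.Re e / 2].
  have uS : (u @ \oo) S by exists n => // m /= /un.
  exists (S, S) => // -[y z] [/= yS zS].
  rewrite -ball_normE/= normE eE ltcR.
  have -> : y - z = (y - u n) - (z - u n) by lmod_start R[i] W; ring.
  by rewrite (le_lt_trans (ler_rnormB _ _))// [ltRHS]splitr ltrD.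
exists (lim (u @ \oo)) => n.
(* The excess over the bound is below $1/(k+1)$ for every $k$, since some late term lies that close
   to the limit; hence the limit keeps the same constant [C]. *)
rewrite -subr_le0; apply: (@le_harmonic_le0 _ 1) => k.
have k0 : 0 < (1 / k.+1%:R : R)%:C by rewrite ltcR divr_gt0.
have /cvgrPdist_lt/(_ _ k0) uP := ucvg.
have [m _ mP] := uP.
have := mP (maxn n m) (leq_maxr _ _); rewrite /= normE ltcR => lu.
have -> : u n - lim (u @ \oo) =
    - (u (maxn n m) - u n) - (lim (u @ \oo) - u (maxn n m)).
  by lmod_start R[i] W; ring.
have := uC n (maxn n m) (leq_maxl _ _).
have := ler_rnormB (- (u (maxn n m) - u n)) (lim (u @ \oo) - u (maxn n m)).
rewrite rnormN => h2 h1.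
by rewrite lerBlDr (le_trans h2)// [leRHS]addrC lerD// ltW.
Unshelve. all: by end_near. Qed.

End harmonic_convergence.

(** * Square roots in C*-algebras *)

Section cstar_basics.
Context {R : realType} {V : cstarAlgType R}.
Implicit Types (a b c h v w x : V) (r : R).

Lemma csmul0l a : csmul 0 a = 0.
Proof. by have := csscaleAl (0 : R[i]) 0 a; rewrite !scale0r. Qed.

Lemma csmul0r a : csmul a 0 = 0.
Proof. by have := csscaleAr (0 : R[i]) a 0; rewrite !scale0r. Qed.

Lemma csmulNl a b : csmul (- a) b = - csmul a b.
Proof. by rewrite -scaleN1r -csscaleAl scaleN1r. Qed.

Lemma csmulNr a b : csmul a (- b) = - csmul a b.
Proof. by rewrite -scaleN1r -csscaleAr scaleN1r. Qed.

Lemma csstarZR r a : csstar (r%:C *: a) = r%:C *: csstar a.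
Proof. by rewrite csstarZ conjc_real. Qed.

Lemma csstarN a : csstar (- a) = - csstar a.
Proof.
have := csstarZR (-1) a; rewrite rmorphN rmorph1.
by rewrite !scaleN1r.
Qed.

Lemma csstar0 : csstar 0 = 0 :> V.
Proof. by have := csstarZR 0 0; rewrite rmorph0 !scale0r. Qed.

Lemma csstarZi a : csstar ('i *: a) = - ('i *: csstar a).
Proof.
rewrite csstarZ -scaleNr; congr (_ *: _).
by apply/eqP; rewrite eq_complex/= oppr0 !eqxx.
Qed.

Lemma scaleii a : 'i *: ('i *: a) = - a.
Proof. by rewrite scalerA -expr2 sqr_i scaleN1r. Qed.

Lemma ler_rnormM a b : rnorm (csmul a b) <= rnorm a * rnorm b.
Proof. by rewrite -lecR rmorphM/= -!normE csnormM. Qed.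

Lemma rnorm_star_sqr a : rnorm (csmul (csstar a) a) = rnorm a ^+ 2.
Proof. by apply: complexI; rewrite rmorphXn/= -!normE csnorm_star. Qed.

Lemma rnorm_star a : rnorm (csstar a) = rnorm a.
Proof.
have half b : rnorm b <= rnorm (csstar b).
  have [->|b0] := eqVneq (rnorm b) 0; first exact: rnorm_ge0.
  have bgt0 : 0 < rnorm b by rewrite lt_def b0 rnorm_ge0.
  by rewrite -(ler_pM2r bgt0) -expr2 -rnorm_star_sqr ler_rnormM.
by apply/eqP; rewrite eq_le half andbT -[leRHS]/(rnorm a) -{2}(csstarK a) half.
Qed.

Lemma csmul_star_eq0 a : csmul (csstar a) a = 0 -> a = 0.
Proof.
move=> a0; apply: rnorm_eq0; apply/eqP; rewrite -sqrf_eq0.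
by rewrite -rnorm_star_sqr a0 rnorm0.
Qed.

(** Testing on $v = a^*$ is enough, because $\|a a^*\| = \|a\|^2$. Norms can thus be estimated
    through left multiplication, which also makes sense for elements of the unitization. *)
Lemma ler_rnorm_opnorm a r : 0 <= r ->
  (forall v, rnorm (csmul a v) <= r * rnorm v) -> rnorm a <= r.
Proof.
move=> r0 /(_ (csstar a)); rewrite rnorm_star.
have := rnorm_star_sqr (csstar a); rewrite csstarK rnorm_star => ->.
have [->//|a0] := eqVneq (rnorm a) 0.
by rewrite expr2 ler_pM2r// lt_def a0 rnorm_ge0.
Qed.

End cstar_basics.

Ltac cs_expand :=
  rewrite ?(csstarD, csstarN, csstarZR, csstarZi, csstarM, csstarK, csstar0);
  rewrite ?(csmulDl, csmulDr, csmulNl, csmulNr, csmul0l, csmul0r,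
            =^~ csscaleAl, =^~ csscaleAr);
  rewrite ?csmulA.

Ltac cs_ring R V := cs_expand; lmod_start (R[i]) V; ring.

(** The cross terms $i(p^*q - q^*p)$ cancel. *)
Lemma csmul_star_i {R : realType} {V : cstarAlgType R} (p q : V) :
  csmul (csstar p) q = csmul (csstar q) p ->
  csmul (csstar (p + 'i *: q)) (p + 'i *: q) =
  csmul (csstar p) p + csmul (csstar q) q.
Proof. by move=> pq; cs_expand; rewrite pq !scaleii; lmod_start (R[i]) V; ring. Qed.

(** * Convergence rate of the scalar iteration *)

Section scalar_iteration.
Context {R : realType}.

Fixpoint rho (n : nat) : R := if n is m.+1 then (1 + rho m ^+ 2) / 2 else 0.

Lemma rho_ge0 n : 0 <= rho n.
Proof. by case: n => //= n; rewrite divr_ge0// addr_ge0// sqr_ge0. Qed.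

Lemma rho_le1 n : rho n <= 1.
Proof. elim: n => [|n IH]/=; first exact: ler01. have := rho_ge0 n; nra. Qed.

Lemma rho_leS n : rho n <= rho n.+1.
Proof. rewrite /=; have := sqr_ge0 (1 - rho n); nra. Qed.

(** The error $d_n = 1 - \rho_n$ satisfies $d_{n+1} = d_n - d_n^2/2$, which decays like $2/n$. *)
Lemma rho_close n : 1 - rho n <= 2 / n.+1%:R.
Proof.
(* The shifted bound stays in $[0,1]$ from $n = 0$ on, and $d - d^2/2$ is increasing there. *)
suff : 1 - rho n <= 2 / n.+2%:R.
  move=> /le_trans; apply; rewrite ler_pM2l ?ltr0n// lef_pV2 ?posrE ?ltr0n//.
  by rewrite ler_nat.
elim: n => [|n IH]; first by rewrite /= subr0 divff// pnatr_eq0.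
set d := 2 / n.+2%:R in IH.
have d0 : 0 < d by rewrite divr_gt0.
have d1 : d <= 1 by rewrite ler_pdivrMr// mul1r ler_nat.
have -> : 1 - rho n.+1 = (1 - rho n) - (1 - rho n) ^+ 2 / 2 by rewrite /=; field.
apply: (@le_trans _ _ (d - d ^+ 2 / 2)).
  have := rho_ge0 n; nra.
rewrite ler_pdivlMr// /d.
have -> : (2 / n.+2%:R - (2 / n.+2%:R) ^+ 2 / 2) * n.+3%:R
  = 2 * (n.+2%:R ^+ 2 - 1) / n.+2%:R ^+ 2 :> R.
  have : n.+2%:R != 0 :> R by rewrite pnatr_eq0.
  by rewrite -[n.+3%:R]natr1; move: (n.+2%:R : R) => k k0; field.
rewrite ler_pdivrMr ?exprn_gt0// ler_pM2l// gerBl//.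
Qed.

End scalar_iteration.

(* Let [u = alpha - w] and [r_(n+1) = (u + r_n^2) / 2] in the unitization.  Then
   [r_n] is a polynomial in the contraction [u] with nonnegative coefficients,
   so it converges at least as fast as the same iteration at [u = 1], which is
   [rho].  Its scalar part is [alpha * rho n] and its part in [V] is
   [- sqiter n].  In the limit, [alpha = 1] gives a square root of [w], and
   [alpha = 0] gives [x] with [(1 + x)^2 = 1 + w]. *)
Section iteration.
Context {R : realType} {V : cstarAlgType R}.
Implicit Types (a b c h v w x : V) (r : R).
Variables (alpha : R) (w : V).
Hypothesis alphaM : alpha * alpha = alpha.
Hypothesis w_star : csstar w = w.
Hypothesis w_le : forall v, rnorm (alpha%:C *: v - csmul w v) <= rnorm v.

Fixpoint sqiter n : V :=
  if n is m.+1 then (2^-1)%:C *: (w + (2 * alpha * rho m)%:C *: sqiter m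
                                 - csmul (sqiter m) (sqiter m))
  else 0.

Let r n v := (alpha * rho n)%:C *: v - csmul (sqiter n) v.

Let alpha_ge0 : 0 <= alpha.
Proof. by rewrite -alphaM -expr2 sqr_ge0. Qed.

Let alpha_le1 : alpha <= 1.
Proof. by have := alphaM; have := sqr_ge0 (1 - alpha); nra. Qed.

Let r0 v : r 0 v = 0.
Proof. by rewrite /r/= mulr0 rmorph0 scale0r csmul0l subrr. Qed.

Let rS n v : r n.+1 v = (2^-1)%:C *: (alpha%:C *: v - csmul w v + r n (r n v)).
Proof.
rewrite /r/=; set x := sqiter n; set t := rho n.
(* As [alpha] is idempotent, the scalar part [alpha * rho n] obeys the recursion started from the
   scalar part of $u$. *)
have -> : alpha * ((1 + t ^+ 2) / 2) = 2^-1 * (alpha + (alpha * t) ^+ 2).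
  by rewrite exprMn [alpha ^+ 2]expr2 alphaM; field.
cs_ring R V.
Qed.

Let rB n v v' : r n (v - v') = r n v - r n v'.
Proof. by rewrite /r; cs_ring R V. Qed.

Let half_norm v : rnorm ((2^-1)%:C *: v) = rnorm v / 2.
Proof. by rewrite rnormZR ger0_norm ?invr_ge0// mulrC. Qed.

Let r_le n v : rnorm (r n v) <= rho n * rnorm v.
Proof.
elim: n v => [|n IH] v; first by rewrite r0 rnorm0 mul0r.
rewrite rS half_norm ler_pdivrMr// [leRHS]mulrAC mulfVK// mulrDl mul1r.
rewrite (le_trans (ler_rnormD _ _))// lerD// (le_trans (IH _))// expr2 -mulrA.
by rewrite ler_wpM2l// rho_ge0.
Qed.

Let r_diffS n v : rnorm (r n.+1 v - r n v) <= (rho n.+1 - rho n) * rnorm v.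
Proof.
elim: n v => [|n IH] v.
  have -> : rho 1 - rho 0 = 2^-1 :> R by rewrite /= subr0 expr0n/= addr0 mul1r.
  by rewrite rS !r0 addr0 subr0 half_norm mulrC ler_pM2l ?invr_gt0.
(* This is $r_{n+1}^2 - r_n^2 = r_{n+1}(r_{n+1} - r_n) + (r_{n+1} - r_n) r_n$; the same splitting
   for [rho] below makes the bounds match term by term. *)
have -> : r n.+2 v - r n.+1 v = (2^-1)%:C *:
    (r n.+1 (r n.+1 v - r n v) + (r n.+1 (r n v) - r n (r n v))).
  rewrite rS [X in _ - X](rS n v) (rB n.+1 (r n.+1 v)); lmod_start R[i] V; ring.
rewrite half_norm ler_pdivrMr//.
have -> : (rho n.+2 - rho n.+1) * rnorm v * 2 =
    rho n.+1 * ((rho n.+1 - rho n) * rnorm v)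
    + (rho n.+1 - rho n) * (rho n * rnorm v).
  by rewrite [rho n.+2]/=; set t := rho n.+1; rewrite /t/=; field.
rewrite (le_trans (ler_rnormD _ _))// lerD//.
  by rewrite (le_trans (r_le _ _))// ler_wpM2l// rho_ge0.
by rewrite (le_trans (IH _))// ler_wpM2l// subr_ge0 rho_leS.
Qed.

Let rho_le n m : (n <= m)%N -> rho n <= rho m :> R.
Proof. exact: homo_leq (@lexx _ _) (@le_trans _ _) rho_leS _ _. Qed.

Let r_diff n m v : (n <= m)%N ->
  rnorm (r m v - r n v) <= (rho m - rho n) * rnorm v.
Proof.
elim: m => [|m IH]; first by rewrite leqn0 => /eqP ->; rewrite !subrr rnorm0 mul0r.
rewrite leq_eqVlt => /predU1P[->|/IH{}IH]; first by rewrite !subrr rnorm0 mul0r.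
have -> : r m.+1 v - r n v = (r m.+1 v - r m v) + (r m v - r n v).
  by lmod_start R[i] V; ring.
rewrite (le_trans (ler_rnormD _ _))// (le_trans (lerD (r_diffS _ _) IH))//.
by rewrite -mulrDl addrA subrK.
Qed.

(** As an operator the difference is $\alpha(\rho_m - \rho_n) - (r_m - r_n)$, and both pieces have
    norm at most $\rho_m - \rho_n \le 2/(n+1)$. *)
Let sqiter_diff n m : (n <= m)%N ->
  rnorm (sqiter m - sqiter n) <= 4 / n.+1%:R.
Proof.
move=> nm; apply: (@le_trans _ _ (2 * (rho m - rho n))).
  apply: ler_rnorm_opnorm.
    by rewrite mulr_ge0// subr_ge0; exact: rho_le.
  move=> v.
  have -> : csmul (sqiter m - sqiter n) v =
      (alpha * (rho m - rho n))%:C *: v - (r m v - r n v).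
    by rewrite /r; cs_ring R V.
  rewrite (le_trans (ler_rnormB _ _))// rnormZR.
  have := r_diff v nm.
  have d0 : 0 <= alpha * (rho m - rho n) by rewrite mulr_ge0// subr_ge0; exact: rho_le.
  rewrite ger0_norm//.
  have : alpha * (rho m - rho n) <= rho m - rho n.
    by rewrite ler_piMl// subr_ge0 rho_le.
  move=> /(ler_wpM2r (rnorm_ge0 v)).
  lra.
have := @rho_close R n; have := @rho_le1 R m.
have -> : 4 / n.+1%:R = 2 * (2 / n.+1%:R) :> R by rewrite mulrA -natrM.
by move: (2 / _) => c; lra.
Qed.

Let sqiter_star n : csstar (sqiter n) = sqiter n.
Proof.
elim: n => [|n IH] /=; first by rewrite csstar0.
by rewrite csstarZR csstarD csstarN csstarD csstarZR csstarM w_star !IH.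
Qed.

Let sqiter_comm n b : csmul w b = csmul b w ->
  csmul (sqiter n) b = csmul b (sqiter n).
Proof.
move=> wb; elim: n => [|n IH] /=; first by rewrite csmul0l csmul0r.
have xxb : csmul (csmul (sqiter n) (sqiter n)) b =
           csmul b (csmul (sqiter n) (sqiter n)).
  by rewrite -csmulA IH csmulA IH -csmulA.
rewrite -csscaleAl -csscaleAr; congr (_ *: _).
rewrite csmulDl csmulDl csmulNl wb -csscaleAl IH xxb.
by cs_ring R V.
Qed.

Lemma sqiter_limit : exists x : V, [/\ csstar x = x,
  2%:R *: x = w + (2 * alpha)%:C *: x - csmul x x,
  forall v, rnorm (alpha%:C *: v - csmul x v) <= rnorm v &
  forall b, csmul w b = csmul b w -> csmul x b = csmul b x].
Proof.
have [x xP] := harmonic_cauchy_lim sqiter_diff.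
pose e n : R := n.+1%:R^-1.
have e0 n : 0 <= e n by rewrite invr_ge0.
have {}xP n : rnorm (sqiter n - x) <= 4 * e n by exact: xP.
have rhoP n : 1 - rho n <= 2 * e n by exact: rho_close.
have eS n : e n.+1 <= e n by rewrite lef_pV2 ?posrE// ler_nat.
have e1 n : e n <= 1 by rewrite invf_le1 ?ler1n.
have le_lim (a C : R) : (forall n, a <= C * e n) -> a <= 0.
  exact: le_harmonic_le0.
(* From here on only the recorded bounds on [e] matter, and the arithmetic tactics see it as an
   atom. *)
clearbody e.
have eq_lim (y z : V) (C : R) : (forall n, rnorm (y - z) <= C * e n) -> y = z.
  move=> yz; apply/eqP; rewrite -subr_eq0; apply/eqP/rnorm_eq0/eqP.
  by rewrite eq_le rnorm_ge0 andbT; exact: le_lim yz.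
exists x; split.
- apply: (eq_lim _ _ 8) => n.
  have -> : csstar x - x = - csstar (sqiter n - x) + (sqiter n - x).
    by rewrite csstarD csstarN sqiter_star; lmod_start R[i] V; ring.
  rewrite (le_trans (ler_rnormD _ _))// rnormN rnorm_star.
  by have := xP n; lra.
- apply: (eq_lim _ _ (32 + 12 * rnorm x)) => n.
  (* The recursion holds exactly at stage $n$, so the defect is a sum of terms each containing
     [sqiter n - x], [sqiter n.+1 - x] or [1 - rho n]. Their bounds [h1] to [h5] add up to the
     constant $32 + 12\|x\|$. *)
  have -> : 2%:R *: x - (w + (2 * alpha)%:C *: x - csmul x x) =
      - (2%:C *: (sqiter n.+1 - x)) + ((2 * alpha * rho n)%:C *: (sqiter n - x)
      + (- ((2 * alpha * (1 - rho n))%:C *: x)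
      - (csmul (sqiter n - x) (sqiter n) + csmul x (sqiter n - x)))).
    by rewrite [sqiter n.+1]/=; cs_expand; lmod_start (R[i]) V; field.
  have xn : rnorm (sqiter n) <= rnorm x + 4.
    rewrite -[sqiter n](subrK x) addrC (le_trans (ler_rnormD _ _))// lerD2l.
    by rewrite (le_trans (xP n))// ler_piMr.
  have ar : 0 <= alpha * rho n by rewrite mulr_ge0 ?rho_ge0.
  have ar1 : alpha * rho n <= 1 by rewrite mulr_ile1 ?rho_ge0 ?rho_le1.
  have ar2 : 0 <= alpha * (1 - rho n) by rewrite mulr_ge0// subr_ge0 rho_le1.
  have ar3 : alpha * (1 - rho n) <= 2 * e n.
    by apply: le_trans (rhoP n); rewrite ler_piMl// subr_ge0 rho_le1.
  rewrite (le_trans (ler_rnormD _ _))//.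
  rewrite (le_trans (lerD (lexx _) (ler_rnormD _ _)))//.
  rewrite (le_trans (lerD (lexx _) (lerD (lexx _) (ler_rnormB _ _))))// [rnorm (- (2%:C *: _))]rnormN.
  have h1 : rnorm (2%:C *: (sqiter n.+1 - x)) <= 8 * e n.
    rewrite rnormZR ger0_norm//.
    by have := xP n.+1; have := eS n; lra.
  have h2 : rnorm ((2 * alpha * rho n)%:C *: (sqiter n - x)) <= 8 * e n.
    rewrite rnormZR -(mulrA 2) ger0_norm; last by rewrite mulr_ge0.
    by have := xP n; have := rnorm_ge0 (sqiter n - x); nra.
  have h3 : rnorm (- ((2 * alpha * (1 - rho n))%:C *: x)) <= 4 * e n * rnorm x.
    rewrite rnormN rnormZR -(mulrA 2) ger0_norm; last by rewrite mulr_ge0.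
    by apply: ler_wpM2r; [exact: rnorm_ge0|lra].
  have h4 : rnorm (csmul (sqiter n - x) (sqiter n)) <= 4 * e n * (rnorm x + 4).
    by rewrite (le_trans (ler_rnormM _ _))// ler_pM ?rnorm_ge0.
  have h5 : rnorm (csmul x (sqiter n - x)) <= rnorm x * (4 * e n).
    by rewrite (le_trans (ler_rnormM _ _))// ler_wpM2l ?rnorm_ge0.
  have h6 := ler_rnormD (csmul (sqiter n - x) (sqiter n)) (csmul x (sqiter n - x)).
  lra.
- move=> v; rewrite -subr_le0; apply: (@le_lim _ (6 * rnorm v)) => n.
  have -> : alpha%:C *: v - csmul x v =
      r n v + ((alpha * (1 - rho n))%:C *: v + csmul (sqiter n - x) v).
    by rewrite /r; cs_ring R V.
  have ar2 : 0 <= alpha * (1 - rho n) by rewrite mulr_ge0// subr_ge0 rho_le1.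
  have ar3 : alpha * (1 - rho n) <= 2 * e n.
    by apply: le_trans (rhoP n); rewrite ler_piMl// subr_ge0 rho_le1.
  have h1 : rnorm (r n v) <= rnorm v.
    by rewrite (le_trans (r_le _ _))// ler_piMl ?rnorm_ge0 ?rho_le1.
  have h2 : rnorm ((alpha * (1 - rho n))%:C *: v) <= 2 * e n * rnorm v.
    by rewrite rnormZR ger0_norm// ler_wpM2r ?rnorm_ge0.
  have h3 : rnorm (csmul (sqiter n - x) v) <= 4 * e n * rnorm v.
    by rewrite (le_trans (ler_rnormM _ _))// ler_wpM2r ?rnorm_ge0.
  have h4 := ler_rnormD (r n v) ((alpha * (1 - rho n))%:C *: v + csmul (sqiter n - x) v).
  have h5 := ler_rnormD ((alpha * (1 - rho n))%:C *: v) (csmul (sqiter n - x) v).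
  lra.
- move=> b wb; apply: (eq_lim _ _ (8 * rnorm b)) => n.
  have -> : csmul x b - csmul b x =
      csmul b (sqiter n - x) - csmul (sqiter n - x) b.
    by rewrite csmulDr csmulDl sqiter_comm//; cs_ring R V.
  rewrite (le_trans (ler_rnormB _ _))//.
  have := ler_rnormM b (sqiter n - x); have := ler_rnormM (sqiter n - x) b.
  have := xP n; have := rnorm_ge0 b; nra.
Qed.

End iteration.

(** * The cone of nonnegative elements and its square roots *)

Section nonnegative.
Context {R : realType} {V : cstarAlgType R}.
Implicit Types (a b c h v w x : V) (r M : R).

(* The norm of [M - h] is at most [M] in the unitization: the spectrum of [h]
   lies in [[0, 2 M]]. *)
Definition nneg h : Prop := csstar h = h /\
  exists2 M, 0 < M & forall v, rnorm (M%:C *: v - csmul h v) <= M * rnorm v.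

Lemma nnegZ r h : 0 < r -> nneg h -> nneg (r%:C *: h).
Proof.
move=> r0 [hh [M M0 hM]]; split; first by rewrite csstarZR hh.
exists (r * M) => [|v]; first by rewrite mulr_gt0.
have -> : (r * M)%:C *: v - csmul (r%:C *: h) v =
    r%:C *: (M%:C *: v - csmul h v) by cs_ring R V.
by rewrite rnormZR gtr0_norm// -mulrA ler_pM2l.
Qed.

Lemma nnegD h k : nneg h -> nneg k -> nneg (h + k).
Proof.
move=> [hh [M M0 hM]] [kk [L L0 kL]]; split; first by rewrite csstarD hh kk.
exists (M + L) => [|v]; first by rewrite addr_gt0.
have -> : (M + L)%:C *: v - csmul (h + k) v =
    (M%:C *: v - csmul h v) + (L%:C *: v - csmul k v) by cs_ring R V.
by rewrite mulrDl (le_trans (ler_rnormD _ _))// lerD.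
Qed.

Lemma nneg_rescale h : nneg h -> exists2 r, 0 < r &
  forall v, rnorm (v - csmul (r%:C *: h) v) <= rnorm v.
Proof.
move=> [hh [M M0 hM]]; exists M^-1 => [|v]; first by rewrite invr_gt0.
have -> : v - csmul (M^-1%:C *: h) v = M^-1%:C *: (M%:C *: v - csmul h v).
  rewrite scalerBr -csscaleAl scalerA -rmorphM/= mulVf ?gt_eqF//.
  by rewrite rmorph1 scale1r.
by rewrite rnormZR gtr0_norm ?invr_gt0// ler_pdivrMl.
Qed.

(** For a suitable $r > 0$, $1 - rh$ is a contraction, and at [alpha = 1] the fixed point equation
    reduces to $x^2 = rh$; the factor $r^{-1/2}$ undoes the scaling. The commutation clause stands
    in for functional calculus in later arguments. *)
Lemma nneg_root h : nneg h -> exists x,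
  [/\ nneg x, csmul x x = h & forall b, csmul h b = csmul b h -> csmul x b = csmul b x].
Proof.
move=> hn; have [r r0 hr] := nneg_rescale hn; case: hn => hh _.
have [|||x [xx xE x_le x_comm]] := @sqiter_limit R V 1 (r%:C *: h).
- exact: mulr1.
- by rewrite csstarZR hh.
- by move=> v; rewrite rmorph1 scale1r.
have xxE : csmul x x = r%:C *: h.
  rewrite mulr1 in xE.
  apply: (addrI (2%:R *: x)); rewrite {1}xE; lmod_start (R[i]) V; ring.
pose s := Num.sqrt r^-1.
have s0 : 0 < s by rewrite sqrtr_gt0 invr_gt0.
exists (s%:C *: x); split.
- apply: nnegZ => //; split => //; exists 1 => // v.
  by rewrite mul1r.
- rewrite -csscaleAl -csscaleAr xxE !scalerA -!rmorphM/= -expr2 sqr_sqrtr.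
    by rewrite mulVf ?gt_eqF// rmorph1 scale1r.
  by rewrite invr_ge0 ltW.
- move=> b hb; rewrite -csscaleAl -csscaleAr x_comm// -csscaleAl -csscaleAr.
  by rewrite hb.
Qed.

(* With [1 - h^2 = (1 + x)^2] and [h] commuting with [x], the operators
   [+-h + i(1 + x)] preserve the norm, and [1 + x] is a combination of them. *)
Lemma nneg_sqr_contraction h : csstar h = h -> rnorm h <= 1 -> nneg (csmul h h).
Proof.
move=> hh h1.
(* At [alpha = 0] and $w = -h^2$ the fixed point equation is $2x = -h^2 - x^2$, that is $(1+x)^2 = 1
   - h^2$. *)
have [|||x [xx xE _ x_comm]] := @sqiter_limit R V 0 (- csmul h h).
- exact: mulr0.
- by rewrite csstarN csstarM hh.
- move=> v; rewrite rmorph0 scale0r sub0r csmulNl opprK -csmulA.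
  rewrite (le_trans (ler_rnormM _ _))// (le_trans (ler_piMl _ _)) ?rnorm_ge0//.
  by rewrite (le_trans (ler_rnormM _ _))// ler_piMl ?rnorm_ge0.
have xxE : csmul x x = - csmul h h - 2%:R *: x.
  rewrite xE mulr0 rmorph0 scale0r addr0; lmod_start (R[i]) V; ring.
have hx : csmul h x = csmul x h.
  by rewrite x_comm// csmulNl csmulNr csmulA.
have sq v : csmul x (csmul x v) = - csmul h (csmul h v) - 2%:R *: csmul x v.
  by rewrite csmulA xxE; cs_ring R V.
pose q v := v + csmul x v.
have isom u v : csstar u = u -> csmul u x = csmul x u -> csmul u u = csmul h h ->
    rnorm (csmul u v + 'i *: q v) = rnorm v.
  move=> uu ux u2.
  apply/eqP; rewrite -(@eqrXn2 _ 2%N) ?rnorm_ge0// -!rnorm_star_sqr csmul_star_i; last first.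
    rewrite /q; cs_expand; rewrite xx uu -(csmulA _ u x) -(csmulA _ x u) ux; cs_ring R V.
  rewrite /q; cs_expand; rewrite xx uu -(csmulA _ u u) u2 -(csmulA _ x x) xxE.
  apply/eqP; congr rnorm; cs_ring R V.
have q_le v : rnorm (q v) <= rnorm v.
  have e1 := isom h v hh hx erefl.
  have e2 : rnorm (csmul (- h) v + 'i *: q v) = rnorm v.
    by apply: isom; rewrite ?(csstarN, csmulNl, csmulNr) ?opprK ?hh ?hx.
  suff : rnorm (2%:C *: ('i *: q v)) <= 2 * rnorm v.
    by rewrite rnormZR rnormZi ger0_norm// ler_pM2l.
  have -> : 2%:C *: ('i *: q v) =
     (csmul h v + 'i *: q v) + (csmul (- h) v + 'i *: q v) by cs_ring R V.
  by rewrite (le_trans (ler_rnormD _ _))// e1 e2 mulr2n mulrDl mul1r.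
split; first by rewrite csstarM hh.
exists 1 => // v; rewrite mul1r.
(* [q] is the action of $1 + x$, so $1 - h^2$ acts as [q] applied twice. *)
have -> : 1%:C *: v - csmul (csmul h h) v = q (q v).
  by rewrite /q csmulDr sq; cs_ring R V.
by rewrite (le_trans (q_le _)).
Qed.

Lemma nneg_sqr h : csstar h = h -> nneg (csmul h h).
Proof.
move=> hh.
have [r r0 rh] : exists2 r, 0 < r & r * rnorm h <= 1.
  have h1 : 0 < rnorm h + 1 by rewrite ltr_wpDl ?rnorm_ge0.
  exists (rnorm h + 1)^-1; first by rewrite invr_gt0.
  by rewrite ler_pdivrMl// mulr1 lerDl ler01.
have := @nneg_sqr_contraction (r%:C *: h).
rewrite csstarZR hh => /(_ erefl); rewrite rnormZR gtr0_norm// => /(_ rh).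
move=> /(@nnegZ (r^-1 ^+ 2)); rewrite exprn_gt0 ?invr_gt0// => /(_ isT).
rewrite -csscaleAl -csscaleAr !scalerA -!rmorphM/=.
have -> : r^-1 ^+ 2 * (r * r) = 1 by field; rewrite gt_eqF.
by rewrite rmorph1 scale1r.
Qed.

(** Commuting self-adjoint roots $s$ of $c$ and $t$ of $-c$ give $(s \pm it)^*(s \pm it) = s^2 + t^2
    = 0$, hence $s = 0$. *)
Lemma nneg_antisym c : nneg c -> nneg (- c) -> c = 0.
Proof.
move=> /nneg_root [s [[ss _] s2 s_comm]] /nneg_root [t [[tt _] t2 t_comm]].
have st : csmul s t = csmul t s.
  apply: s_comm; symmetry; apply: t_comm.
  by rewrite csmulNl csmulNr -s2 csmulA.
have null u : csstar u = u -> csmul u u = - c -> csmul s u = csmul u s ->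
    s + 'i *: u = 0.
  move=> uu u2 su; apply: csmul_star_eq0.
  by rewrite csmul_star_i ss uu// s2 u2 subrr.
have e1 := null t tt t2 st.
have e2 : s + 'i *: - t = 0.
  by apply: null; rewrite ?csstarN ?csmulNl ?csmulNr ?opprK ?tt ?st.
suff s0 : s = 0 by rewrite -s2 s0 csmul0l.
have : 2%:C *: s = 0.
  rewrite -[RHS]addr0 -{1}e1 -e2; lmod_start (R[i]) V; ring.
by move=> /eqP; rewrite scaler_eq0 => /orP[|/eqP//]; rewrite fmorph_eq0 pnatr_eq0.
Qed.

End nonnegative.

(** If $d = x - 1 > 0$, squaring Bernoulli's inequality gives $x^{2k} \ge (1 + kd)^2$, whose term
    $k^2 d^2$ outgrows the linear bound $2kK$. *)
Lemma linear_growth_le1 {R : realType} (x K : R) :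
  0 <= x -> (forall m, x ^+ m <= 1 + m%:R * K) -> x <= 1.
Proof.
move=> x0 xK; rewrite leNgt; apply/negP; rewrite -subr_gt0.
set d := x - 1 => d0.
have bernoulli m : 1 + m%:R * d <= x ^+ m.
  elim: m => [|m IH]; first by rewrite mul0r addr0.
  rewrite exprS -natr1; apply: le_trans (ler_wpM2l x0 IH).
  have -> : x = 1 + d by rewrite /d addrC subrK.
  have : 0 <= m%:R * (d * d) by rewrite !mulr_ge0// ltW.
  by move: (m%:R) => k; lra.
have [m mP] : exists m : nat, 2 * K / d ^+ 2 < m.+1%:R.
  by exists (Num.truncn (2 * K / d ^+ 2)); exact: truncnS_gt.
rewrite ltr_pdivrMr ?exprn_gt0// in mP.
have := xK (m.+1 * 2)%N; rewrite exprM natrM.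
have := bernoulli m.+1; have : 1 <= m.+1%:R :> R by rewrite ler1n.
move: (m.+1%:R : R) (x ^+ m.+1) mP => k y.
move=> kK k1 yk yK.
have k0 : 0 < k by rewrite (lt_le_trans ltr01).
have kd : 0 < k * d by rewrite mulr_gt0.
have y2 : (1 + k * d) ^+ 2 <= y ^+ 2 by rewrite lerXn2r// nnegrE; lra.
have : 2 * K * k < k * d ^+ 2 * k by rewrite ltr_pM2r.
lra.
Qed.

(** * Nonnegativity of $a^*a$ and the modulus *)

Section fukamiya.
Context {R : realType} {V : cstarAlgType R}.
Implicit Types (a b c h v w x : V) (r M : R).

(* [S = 1 - r b^* b] satisfies [b S^m = (1 - r b b^* )^m b], so the norms of
   its powers grow at most linearly; being self-adjoint, it is a contraction. *)
Lemma nneg_swap b : nneg (csmul b (csstar b)) -> nneg (csmul (csstar b) b).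
Proof.
move=> bb; have [r r0 T_le] := nneg_rescale bb.
split; first by rewrite csstarM csstarK.
pose S v := v - csmul (r%:C *: csmul (csstar b) b) v.
pose T v := v - csmul (r%:C *: csmul b (csstar b)) v.
have ST v : csmul b (S v) = T (csmul b v) by rewrite /S /T; cs_ring R V.
have STm m v : csmul b (iter m S v) = iter m T (csmul b v).
  by elim: m => //= m IH; rewrite ST IH.
have T_lem m v : rnorm (iter m T v) <= rnorm v.
  by elim: m => //= m IH; exact: le_trans (T_le _) IH.
(* Since $S^{m+1}v = S^m v - r\,b^* T^m b v$ and $T$ is a contraction, each application of $S$ adds
   at most $r\|b\|^2\|v\|$. *)
have S_lem m v : rnorm (iter m S v) <= (1 + m%:R * (r * rnorm b ^+ 2)) * rnorm v.
  elim: m => [|m IH]; first by rewrite mul0r addr0 mul1r.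
  have -> : iter m.+1 S v = iter m S v - r%:C *: csmul (csstar b) (iter m T (csmul b v)).
    by rewrite -STm /= {1}/S; cs_ring R V.
  rewrite (le_trans (ler_rnormB _ _))// -natr1.
  have : rnorm (r%:C *: csmul (csstar b) (iter m T (csmul b v)))
      <= r * rnorm b ^+ 2 * rnorm v.
    rewrite rnormZR gtr0_norm// -mulrA ler_pM2l// (le_trans (ler_rnormM _ _))//.
    rewrite rnorm_star expr2 -mulrA ler_wpM2l ?rnorm_ge0//.
    by rewrite (le_trans (T_lem _ _))// ler_rnormM.
  move: (m%:R) IH => k; lra.
have S_cvx v : rnorm (S v) ^+ 2 <= rnorm v * rnorm (S (S v)).
  rewrite -rnorm_star_sqr.
  have -> : csmul (csstar (S v)) (S v) = csmul (csstar v) (S (S v)).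
    by rewrite /S; cs_ring R V.
  by rewrite (le_trans (ler_rnormM _ _))// rnorm_star.
have S_le v : rnorm (S v) <= rnorm v.
  have [v0|v0] := eqVneq (rnorm v) 0.
    by have := S_lem 1%N v; rewrite v0 mulr0.
  have vgt0 : 0 < rnorm v by rewrite lt_def v0 rnorm_ge0.
  (* By [S_cvx], no ratio of successive norms $\|S^{m+1}v\| / \|S^m v\|$ is below the first one. The
     division-free form covers vanishing iterates. *)
  have ratio m : rnorm (S v) * rnorm (iter m S v) <= rnorm (iter m.+1 S v) * rnorm v.
    elim: m => [//|m]; have := S_cvx (iter m S v).
    rewrite /=; have := rnorm_ge0 (iter m S v); have := rnorm_ge0 (S (S (iter m S v))).
    have := rnorm_ge0 (S (iter m S v)); have := rnorm_ge0 (S v).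
    move: (rnorm (S (S _))) (rnorm (iter m S v)) (rnorm (S (iter m S v))) (rnorm (S v)) => a2 a0 a1 q.
    move=> q0 a1_ge0 a2_ge0 a0_ge0 cvx qa.
    have [->|a1_neq0] := eqVneq a1 0; first by rewrite mulr0 mulr_ge0// ltW.
    have a1_gt0 : 0 < a1 by rewrite lt_def a1_neq0.
    rewrite -(ler_pM2r a1_gt0) -mulrA -expr2.
    apply: (le_trans (ler_wpM2l q0 cvx)); rewrite mulrA.
    by apply: (le_trans (ler_wpM2r a2_ge0 qa)); rewrite -mulrA mulrC mulrAC mulrC mulrA.
  have pow m : (rnorm (S v) / rnorm v) ^+ m * rnorm v <= rnorm (iter m S v).
    elim: m => [|m IH]; first by rewrite mul1r.
    rewrite exprS -(ler_pM2r vgt0); apply: le_trans (ratio m).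
    move: (_ ^+ m) IH => y IH.
    have -> : rnorm (S v) / rnorm v * y * rnorm v * rnorm v =
        rnorm (S v) * (y * rnorm v) by field.
    by rewrite ler_wpM2l ?rnorm_ge0.
  suff : rnorm (S v) / rnorm v <= 1 by rewrite ler_pdivrMr// mul1r.
  apply: (@linear_growth_le1 _ _ (r * rnorm b ^+ 2)).
    by rewrite divr_ge0 ?rnorm_ge0.
  by move=> m; rewrite -(ler_pM2r vgt0) (le_trans (pow m)).
exists r^-1 => [|v]; first by rewrite invr_gt0.
have -> : (r^-1)%:C *: v - csmul (csmul (csstar b) b) v = r^-1%:C *: S v.
  rewrite /S scalerBr -csscaleAl scalerA -rmorphM/= mulVf ?gt_eqF//.
  by rewrite rmorph1 scale1r.
by rewrite rnormZR gtr0_norm ?invr_gt0// ler_pM2l ?invr_gt0.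
Qed.

Lemma nneg_star_mul a : nneg (csmul (csstar a) a).
Proof.
have hh : csstar (csmul (csstar a) a) = csmul (csstar a) a.
  by rewrite csstarM csstarK.
(* An abstract [h] keeps associativity rewriting from reaching inside the product. *)
have [h hE] : exists h, h = csmul (csstar a) a by exists (csmul (csstar a) a).
rewrite -!hE in hh *.
have [k [kn k2 k_comm]] := nneg_root (nneg_sqr hh).
have kh : csmul k h = csmul h k by apply: k_comm; rewrite csmulA.
(* With $s^2 = k$, the self-adjoint $g = sn$ below has $g^2 = nkn$; and $b^*b = nhn = -nkn$ because
   $n(h + k) = k^2 - h^2 = 0$. *)
have [s [[ss _] s2 s_comm]] := nneg_root kn.
have sh : csmul s h = csmul h s by apply: s_comm.
have sk : csmul s k = csmul k s by apply: s_comm.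
case: (kn) => kk _.
pose n := k - h.
have nn : csstar n = n by rewrite csstarD csstarN hh kk.
have sn : csmul s n = csmul n s by rewrite csmulDl csmulDr csmulNl csmulNr sh sk.
have nhk : csmul n (h + k) = 0.
  by rewrite /n; cs_expand; rewrite k2 kh; lmod_start (R[i]) V; ring.
pose g := csmul s n; have gg : csstar g = g by rewrite csstarM nn ss -sn.
have g2 : csmul g g = csmul (csmul n k) n.
  by rewrite /g {1}sn -csmulA (csmulA s) s2 csmulA.
pose b := csmul a n.
have bb : csmul (csstar b) b = - csmul g g.
  apply/eqP; rewrite -subr_eq0 opprK; apply/eqP.
  have -> : csmul (csstar b) b = csmul (csmul n h) n.
    by rewrite /b csstarM nn hE !csmulA.
  by rewrite g2 -csmulDl -csmulDr nhk csmul0l.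
have bb0 : csmul (csstar b) b = 0.
  apply: nneg_antisym; last by rewrite bb opprK; exact: nneg_sqr.
  apply: nneg_swap.
  have -> : csmul b (csstar b) = (2^-1)%:C *: csmul (b + csstar b) (b + csstar b)
     + (2^-1)%:C *: csmul ('i *: (b - csstar b)) ('i *: (b - csstar b)) + csmul g g.
    rewrite -[csmul g g]opprK -bb -csscaleAl -csscaleAr scaleii.
    by cs_expand; lmod_start (R[i]) V; field.
  apply: nnegD; last exact: nneg_sqr.
  apply: nnegD; apply: nnegZ; rewrite ?invr_gt0//; apply: nneg_sqr.
    by rewrite csstarD csstarK addrC.
  by rewrite csstarZi csstarD csstarN csstarK -scalerN opprB.
have g0 : g = 0.
  apply: csmul_star_eq0; rewrite gg; apply: oppr_inj.
  by rewrite -bb bb0 oppr0.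
have kn0 : csmul k n = 0 by rewrite -s2 -csmulA -/g g0 csmul0r.
have hn0 : csmul h n = 0.
  have hn : csmul h n = csmul n h by rewrite /n csmulDl csmulDr csmulNl csmulNr kh.
  have kn' : csmul k n = csmul n k by rewrite /n csmulDl csmulDr csmulNl csmulNr kh.
  by move: nhk; rewrite csmulDr -kn' kn0 addr0 hn.
(* Both $kn$ and $hn$ vanish, so $n^2 = (k - h)n = 0$; then $h = k$. *)
have n0 : n = 0.
  by apply: csmul_star_eq0; rewrite nn {1}/n csmulDl csmulNl kn0 hn0 subr0.
by move/eqP: n0; rewrite subr_eq0 => /eqP <-.
Qed.

Lemma cssqr_csabs a : cssqr (csabs a) = csmul (csstar a) a.
Proof.
have [x [xn x2 _]] := nneg_root (nneg_star_mul a).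
(* [cspos] asks for the form $z^*z$, which a self-adjoint root of the root provides. *)
have [z [[zz _] z2 _]] := nneg_root xn.
rewrite /csabs /cssqrt; case: xgetP => [y _ []//|/(_ x) []].
by split=> //; exists z; rewrite zz z2.
Qed.

End fukamiya.

(** * Norming functionals *)

Lemma le_inf_add {R : realType} (A B : set R) (a : R) : A !=set0 -> B !=set0 ->
  (forall u v, A u -> B v -> a <= u + v) -> a <= inf A + inf B.
Proof.
move=> A0 B0 AB; rewrite -lerBlDr; apply: lb_le_inf => // u Au.
rewrite lerBlDr addrC -lerBlDr; apply: lb_le_inf => // v Bv.
by rewrite lerBlDr addrC AB.
Qed.

Section hahn_banach.
Context {R : realType} {W : normedModType R[i]}.
Implicit Types (x y v : W) (r t : R) (p q : W -> R).

Definition sublinear q : Prop :=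
  (forall x y, q (x + y) <= q x + q y) /\
  (forall r x, 0 < r -> q (r%:C *: x) = r * q x).

Definition real_linear q : Prop :=
  (forall x y, q (x + y) = q x + q y) /\
  (forall r x, q (r%:C *: x) = r * q x).

Lemma sublinear0 q : sublinear q -> q 0 = 0.
Proof. by case=> _ /(_ 2 0 (ltr0Sn R 1)); rewrite scaler0; lra. Qed.

Lemma sublinear_ge q x : sublinear q -> - q (- x) <= q x.
Proof.
move=> qs; have := sublinear0 qs; case: qs => qD _ q0.
by have := qD x (- x); rewrite subrr q0; lra.
Qed.

Lemma sublinearZ_half q : (forall x y, q (x + y) <= q x + q y) ->
  (forall r x, 0 < r -> q (r%:C *: x) <= r * q x) -> sublinear q.
Proof.
move=> qD qZ; split => // r x r0; apply/eqP; rewrite eq_le qZ//=.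
rewrite -ler_pdivlMl// (le_trans _ (qZ _ _ _)) ?invr_gt0//.
by rewrite scalerA -rmorphM/= mulVf ?gt_eqF// rmorph1 scale1r.
Qed.

(* The greatest sublinear functional below [q] with value [- q y] at [- y]. *)
Definition sublinear_at q y x : R :=
  inf [set q (x + t%:C *: y) - t * q y | t in [set t | 0 <= t]].

Section sublinear_at.
Variables (q : W -> R) (y : W).
Hypothesis qs : sublinear q.

Let qZ t : 0 <= t -> q (t%:C *: y) = t * q y.
Proof.
rewrite le_eqVlt => /predU1P[<-|/(qs.2 t y)//].
by rewrite rmorph0 scale0r mul0r sublinear0.
Qed.

Lemma sublinear_at_le x t : 0 <= t ->
  sublinear_at q y x <= q (x + t%:C *: y) - t * q y.
Proof.
move=> t0; apply: ge_inf; last by exists t.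
(* Lower bound from $q(sy) \le q(x + sy) + q(-x)$. *)
exists (- q (- x)) => _ [s s0 <-]; rewrite -(qZ s0).
have := qs.1 (x + s%:C *: y) (- x); rewrite addrAC subrr add0r; lra.
Qed.

Let at_neq0 x :
  [set q (x + t%:C *: y) - t * q y | t in [set t | 0 <= t]] !=set0.
Proof. by exists (q (x + 0%:C *: y) - 0 * q y), 0 => //=. Qed.

Lemma sublinear_at_sublinear : sublinear (sublinear_at q y).
Proof.
apply: sublinearZ_half => [x x'|r x r0].
  apply: le_inf_add => //.
  move=> _ _ [t t0 <-] [s s0 <-].
  have ts : 0 <= t + s by rewrite addr_ge0.
  apply: (le_trans (sublinear_at_le _ ts)).
  have := qs.1 (x + t%:C *: y) (x' + s%:C *: y).
  have -> : x + t%:C *: y + (x' + s%:C *: y) = x + x' + (t + s)%:C *: y.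
    by lmod_start (R[i]) W; ring.
  lra.
rewrite -ler_pdivrMl//; apply: lb_le_inf => //.
move=> _ [t t0 <-]; rewrite ler_pdivrMl//.
have rt : 0 <= r * t by rewrite mulr_ge0// ltW.
apply: (le_trans (sublinear_at_le _ rt)).
by rewrite rmorphM -scalerA -scalerDr qs.2// -mulrA mulrBr.
Qed.

Lemma sublinear_at_le_self x : sublinear_at q y x <= q x.
Proof.
have := sublinear_at_le x (lexx 0).
by rewrite rmorph0 scale0r addr0 mul0r subr0.
Qed.

Lemma sublinear_at_opp : sublinear_at q y (- y) <= - q y.
Proof.
have := sublinear_at_le (- y) ler01.
by rewrite rmorph1 scale1r addNr sublinear0// mul1r sub0r.
Qed.

End sublinear_at.

(** The pointwise infimum is finite, being bounded below by $-p(-x)$. It is subadditive because of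
    any two members of the chain the smaller one can serve for both arguments. *)
Lemma sublinear_chain_inf p (A : set (W -> R)) : A !=set0 ->
  (forall q, A q -> sublinear q /\ forall x, q x <= p x) ->
  (forall q q', A q -> A q' -> (forall x, q x <= q' x) \/ (forall x, q' x <= q x)) ->
  exists2 q, sublinear q & forall q' x, A q' -> q x <= q' x.
Proof.
move=> [q0 Aq0] Ap Atot; pose q x := inf [set q' x | q' in A].
have A0 x : [set q' x | q' in A] !=set0 by exists (q0 x), q0.
have q_le q' x : A q' -> q x <= q' x.
  move=> Aq'; apply: ge_inf; last by exists q'.
  exists (- p (- x)) => _ [s /Ap[ss sp] <-].
  by rewrite (le_trans _ (sublinear_ge _ ss))// lerN2.
exists q => //; apply: sublinearZ_half => [x y|r x r0].
  apply: le_inf_add => // _ _ [q1 A1 <-] [q2 A2 <-].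
  have [q12|q21] := Atot _ _ A1 A2.
    rewrite (le_trans (q_le _ _ A1))// (le_trans ((Ap _ A1).1.1 _ _))//.
    by rewrite lerD2l.
  rewrite (le_trans (q_le _ _ A2))// (le_trans ((Ap _ A2).1.1 _ _))//.
  by rewrite lerD2r.
rewrite -ler_pdivrMl//; apply: lb_le_inf => // _ [q' Aq' <-].
by rewrite ler_pdivrMl// -(Ap _ Aq').1.2// q_le.
Qed.

(* A minimal sublinear functional [q] equals every [sublinear_at q y], which
   forces it to be additive. *)
Lemma sublinear_dominates p : sublinear p ->
  exists2 q, real_linear q & forall x, q x <= p x.
Proof.
move=> ps; pose T := {q | sublinear q /\ forall x, q x <= p x}.
(* The order is reversed, so that a maximal element in Zorn's lemma is a minimal functional. *)
pose below (q q' : T) := `[< forall x, sval q' x <= sval q x >].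
have pT : sublinear p /\ forall x, p x <= p x by [].
have [||||[q [qs qp]] qmax] := @Zorn T below.
- by move=> q; apply/asboolP => x.
- move=> q1 q2 q3 /asboolP h1 /asboolP h2; apply/asboolP => x.
  exact: le_trans (h2 x) (h1 x).
- move=> [q1 h1] [q2 h2] /asboolP/= h12 /asboolP/= h21.
  by apply: eq_exist; apply/funext => x; apply/eqP; rewrite eq_le h12 h21.
- move=> A Atot; have [[a Aa]|A0] := pselect (A !=set0); last first.
    by exists (exist _ p pT) => s As; exfalso; apply: A0; exists s.
  have [|||q qs qle] := @sublinear_chain_inf p [set sval q | q in A].
  + by exists (sval a), a.
  + by move=> _ [q Aq <-]; exact: svalP q.
  + move=> _ _ [q1 A1 <-] [q2 A2 <-].
    by have [/asboolP|/asboolP] := Atot _ _ A1 A2; [right|left].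
  have qT : sublinear q /\ forall x, q x <= p x.
    split=> // x; apply: le_trans ((svalP a).2 x); apply: qle.
    by exists a.
  exists (exist _ q qT) => s As; apply/asboolP => x /=.
  by apply: qle; exists s.
have qat y x : q x <= q (x + y) - q y.
  have atT : sublinear (sublinear_at q y) /\ forall x, sublinear_at q y x <= p x.
    split; first exact: sublinear_at_sublinear.
    by move=> z; rewrite (le_trans (sublinear_at_le_self _ qs _)).
  have := qmax (exist _ _ atT).
  have bel : below (exist _ q (conj qs qp)) (exist _ _ atT).
    by apply/asboolP => z /=; exact: sublinear_at_le_self.
  move=> /(_ bel) [qE].
  by have := sublinear_at_le y qs x ler01; rewrite qE rmorph1 scale1r mul1r.
have qD x y : q (x + y) = q x + q y.
  by apply/eqP; rewrite eq_le qs.1/= -lerBrDr.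
have qN x : q (- x) = - q x.
  by have := qD x (- x); rewrite subrr sublinear0//; lra.
exists q => //; split => // r x.
have [r0|r0|->] := ltgtP r 0; last by rewrite rmorph0 scale0r mul0r sublinear0.
  have := qs.2 (- r) x; rewrite oppr_gt0 => /(_ r0).
  by rewrite rmorphN scaleNr qN mulNr => /oppr_inj.
exact: qs.2.
Qed.

(** A linear functional below [sublinear_at rnorm v] is at most $-\|v\|$ at $-v$, which forces the
    value $\|v\|$ at $v$. *)
Lemma norming_functional v : exists q : W -> R,
  [/\ real_linear q, forall x, `|q x| <= rnorm x & q v = rnorm v].
Proof.
have Ns : sublinear (@rnorm R W).
  split; first exact: ler_rnormD.
  by move=> r x r0; rewrite rnormZR gtr0_norm.
have [q ql q_le] := sublinear_dominates (sublinear_at_sublinear v Ns).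
have q_le_norm x : q x <= rnorm x.
  by rewrite (le_trans (q_le _))// sublinear_at_le_self.
have qN x : q (- x) = - q x.
  by rewrite -scaleN1r -(rmorphN1 (real_complex R)) ql.2 mulN1r.
exists q; split => //.
  by move=> x; rewrite ler_norml q_le_norm andbT lerNl -qN -rnormN.
apply/eqP; rewrite eq_le q_le_norm/= -lerN2 -qN (le_trans (q_le _))//.
exact: sublinear_at_opp.
Qed.

End hahn_banach.

(** * Integration of continuous fields *)

Section borel_continuous.
Context {R : realType} {T : ptopologicalType}.

Lemma borel_open (U : set T) : open U -> measurable (U : set (borel T)).
Proof. by move=> oU; exact: sub_sigma_algebra. Qed.

Lemma borel_compact (K : set T) : hausdorff_space T -> compact K ->
  measurable (K : set (borel T)).
Proof.
move=> hT cK; rewrite -[K]setCK; apply: measurableC; apply: borel_open.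
by apply: closed_openC; exact: compact_closed.
Qed.

Lemma continuous_borel_measurable (g : T -> R) : continuous g ->
  measurable_fun [set: borel T] (g : borel T -> R).
Proof.
move=> /continuousP cg; apply: (measurability _ (RGenOpens.measurableE R)).
move=> _ [_ [a [b ->]] <-]; rewrite setTI; apply: borel_open; apply: cg.
exact: interval_open.
Qed.

Lemma continuous_rnorm_lipschitz {W : normedModType R[i]} (g : W -> R) (C : R) :
  (forall x y, `|g x - g y| <= C * rnorm (x - y)) -> continuous g.
Proof.
move=> gC x; apply/cvgrPdist_lt => e e0.
have C0 : 0 < `|C| + 1 by rewrite ltr_wpDl.
pose d := e / (`|C| + 1).
have d0 : 0 < d by rewrite divr_gt0.
apply/nbhs_ballP; exists d%:C; first by rewrite /= ltcR.
move=> y; rewrite -ball_normE/= normE ltcR => xy.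
apply: le_lt_trans (gC x y) _.
apply: (@le_lt_trans _ _ ((`|C| + 1) * rnorm (x - y))).
  rewrite ler_wpM2r ?rnorm_ge0// (le_trans (ler_norm _))// lerDl//.
by rewrite -ltr_pdivlMl// mulrC.
Qed.

Lemma continuous_rnorm {W : normedModType R[i]} : continuous (@rnorm R W).
Proof.
apply: (@continuous_rnorm_lipschitz _ _ 1) => x y; rewrite mul1r ler_norml.
have := ler_rnormD (x - y) y; have := ler_rnormD (y - x) x.
by rewrite !subrK -(opprB x) rnormN; lra.
Qed.

End borel_continuous.

Lemma real_linearB {R : realType} {W : normedModType R[i]} (q : W -> R) x y :
  real_linear q -> q (x - y) = q x - q y.
Proof.
by move=> [qD qZ]; rewrite -scaleN1r -(rmorphN1 (real_complex R)) qD qZ mulN1r.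
Qed.

Lemma continuous_real_linear {R : realType} {W : normedModType R[i]}
    (q : W -> R) (C : R) :
  real_linear q -> (forall x, `|q x| <= C * rnorm x) -> continuous q.
Proof.
move=> ql qC; apply: (@continuous_rnorm_lipschitz _ _ _ C) => x y.
by rewrite -real_linearB.
Qed.

Section simple_approximation.
Context {R : realType} {W : completeNormedModType R[i]} {T : ptopologicalType}.
Variable P : probability (borel T) R.
Implicit Types (f : T -> W) (v : W) (q : W -> R).

Lemma integrable_real_linear f q C : continuous f -> norm_integrable P f ->
  real_linear q -> (forall x, `|q x| <= C * rnorm x) ->
  P.-integrable [set: borel T] (EFin \o (q \o f)).
Proof.
move=> cf fi ql qC.
apply: (@le_integrable _ (borel T) R P setT measurableT _
  (fun x => (C%:E * (rnorm (f x))%:E)%E)).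
- apply/measurable_EFinP; apply: continuous_borel_measurable => x.
  apply: continuous_comp; first exact: cf.
  exact: (continuous_real_linear ql qC).
- move=> x _ /=; rewrite lee_fin (le_trans (qC _))//; exact: ler_norm.
- exact: (integrableZl measurableT _ fi).
Qed.

(** The test class is that of the functionals produced by [norming_functional]: real-linear, of norm
    at most one. *)
Definition weak_integral f v : Prop := forall q, real_linear q ->
  (forall x, `|q x| <= rnorm x) -> q v = \int[P]_(x in [set: borel T]) q (f x).

(** The vector is the integral of the simple function sending $t$ to the first centre of [s] within
    [e] of $f(t)$; induction on [s] peels off one centre at a time. The choice of [v] precedes [q],
    so the error is uniform in [q]. *)
Lemma covered_approx f (s : seq W) (B : set (borel T)) (e : R) :
  continuous f -> norm_integrable P f -> measurable B ->
  (forall t, B t -> exists2 c, c \in s & rnorm (f t - c) < e) ->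
  exists v, forall q, real_linear q -> (forall x, `|q x| <= rnorm x) ->
    `|q v - \int[P]_(x in B) q (f x)| <= e * fine (P B).
Proof.
move=> cf fi; elim: s B => [|c s IH] B mB Bs.
  have -> : B = set0 by rewrite -subset0 => t /Bs[].
  exists 0 => q [_ qZ] _; rewrite Rintegral_set0 subr0.
  have := qZ 0 0; rewrite scaler0 mul0r => ->.
  by rewrite normr0 measure0 mulr0.
pose U : set (borel T) := [set t | rnorm (f t - c) < e].
have mU : measurable U.
  apply: borel_open; apply: (@open_comp _ _ (fun t => rnorm (f t - c)) [set r | r < e]).
    move=> t _; apply: continuous_comp; last exact: continuous_rnorm.
    by apply: continuousB; [exact: cf|exact: cvg_cst].
  exact: open_lt.
have mBU : measurable (B `&` U) by exact: measurableI.
have mBD : measurable (B `\` U) by exact: measurableD.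
have [|v vP] := IH (B `\` U) mBD.
  move=> t [Bt Ut]; have [d + dt] := Bs t Bt.
  by rewrite inE => /predU1P[dc|]; [case: Ut; rewrite /U/= -dc|exists d].
exists ((fine (P (B `&` U)))%:C *: c + v) => q ql qN.
have qi : P.-integrable [set: borel T] (EFin \o (q \o f)).
  by apply: (integrable_real_linear (C := 1)) => // x; rewrite mul1r.
have qiS D : measurable D -> P.-integrable D (EFin \o (q \o f)).
  by move=> mD; apply: integrableS qi => //; exact: measurableT.
rewrite ql.1 ql.2.
have BE : B = (B `&` U) `|` (B `\` U) by rewrite setUIDK.
have BI : (B `&` U) `&` (B `\` U) = set0.
  by rewrite -subset0 => x [[_ Ux] [_ /(_ Ux)]].
have PE : P B = (P (B `&` U) + P (B `\` U))%E by rewrite {1}BE measureU.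
have IE : \int[P]_(x in B) q (f x) =
    \int[P]_(x in B `&` U) q (f x) + \int[P]_(x in B `\` U) q (f x).
  rewrite {1}BE Rintegral_setU//; first by rewrite -BE; exact: qiS.
  exact/disj_set2P.
rewrite PE IE fineD ?fin_num_measure//.
rewrite opprD addrACA mulrDr (le_trans (ler_normD _ _))// lerD//; last exact: vP.
have -> : fine (P (B `&` U)) * q c = \int[P]_(x in B `&` U) q c.
  by rewrite Rintegral_cst// mulrC.
have ci k : P.-integrable (B `&` U) (EFin \o (fun=> k)).
  exact: finite_measure_integrable_cst.
rewrite -RintegralB//; last exact: qiS.
have di : P.-integrable (B `&` U) (EFin \o (fun x => q c - q (f x))).
  exact: (integrableB mBU (ci _) (qiS _ mBU)).
apply: (le_trans (le_normr_Rintegral mBU di)).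
rewrite -Rintegral_cst//; apply: le_Rintegral => //.
  exact: (integrable_norm di).
move=> x [_ Ux]; rewrite -real_linearB// (le_trans (qN _))//.
by rewrite -rnormN opprB ltW.
Qed.

End simple_approximation.

Section weak_integral.
Context {R : realType} {W : completeNormedModType R[i]} {T : ptopologicalType}.
Variable P : probability (borel T) R.
Hypothesis T_hausdorff : hausdorff_space T.
Hypothesis P_radon : radon P.
Implicit Types (f : T -> W) (v : W) (q : W -> R).

Lemma radon_tight (d : R) : 0 < d ->
  exists2 K : set T, compact K & (P (~` (K : set (borel T))) < d%:E)%E.
Proof.
move=> d0; apply: contrapT => noK.
have P1 := P_radon.2 _ (@measurableT _ (borel T)).
have : (P [set: borel T] <= (1 - d)%:E)%E.
  rewrite P1; apply: ge_ereal_sup => _ [K [cK _] <-].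
  have mK : measurable (K : set (borel T)) by exact: borel_compact.
  rewrite leNgt; apply/negP => dK; apply: noK; exists K => //.
  have [p pE] : exists p, P (K : set (borel T)) = p%:E.
    by exists (fine (P (K : set (borel T)))); rewrite fineK ?fin_num_measure.
  have {}dK : ((1 - d)%:E < P (K : set (borel T)))%E := dK.
  move: dK; rewrite probability_setC// pE -EFinB !lte_fin; lra.
by rewrite probability_setT lee_fin; lra.
Qed.

Lemma compact_cover_balls f (K : set T) (e : R) : 0 < e -> continuous f ->
  compact K -> exists s : seq W, forall t, K t ->
    exists2 c, c \in s & rnorm (f t - c) < e.
Proof.
move=> e0 cf; rewrite compact_cover => /(_ T K (fun u => [set t | rnorm (f t - f u) < e])).
case.
- move=> u _; apply: (@open_comp _ _ (fun t => rnorm (f t - f u)) [set r | r < e]).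
    move=> t _; apply: continuous_comp; last exact: continuous_rnorm.
    by apply: continuousB; [exact: cf|exact: cvg_cst].
  exact: open_lt.
- by move=> t Kt; exists t => //=; rewrite subrr rnorm0.
move=> D _ KD; exists [seq f u | u <- finmap.enum_fset D] => t /KD[u /= uD fu].
by exists (f u) => //; apply: map_f.
Qed.

(** Half of [e] pays for the simple approximation on a compact [K], half for the complement, where
    absolute continuity makes the integral of the norm small. *)
Lemma weak_integral_approx f (e : R) : continuous f -> norm_integrable P f ->
  0 < e -> exists v, forall q, real_linear q -> (forall x, `|q x| <= rnorm x) ->
  `|q v - \int[P]_(x in [set: borel T]) q (f x)| <= e.
Proof.
move=> cf fi e0; have e2 : 0 < e / 2 by rewrite divr_gt0.
have [d [d0 dP]] := integral_normr_continuous fi e2.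
have [K cK Kd] := radon_tight d0.
have mK : measurable (K : set (borel T)) by exact: borel_compact.
have mKC : measurable (~` K : set (borel T)) by exact: measurableC.
have [s sP] := compact_cover_balls e2 cf cK.
have [v vP] := covered_approx cf fi mK sP.
exists v => q ql qN.
have qi : P.-integrable [set: borel T] (EFin \o (q \o f)).
  by apply: (integrable_real_linear (C := 1)) => // x; rewrite mul1r.
have -> : \int[P]_(x in [set: borel T]) q (f x) =
    \int[P]_(x in K) q (f x) + \int[P]_(x in ~` K) q (f x).
  rewrite -(setUv (K : set (borel T))) Rintegral_setU//; first by rewrite setUv.
  by apply/disj_set2P; rewrite setICr.
rewrite opprD addrA (le_trans (ler_normB _ _))// [leRHS]splitr lerD//.
  apply: (le_trans (vP q ql qN)); apply: ler_piMr; first exact: ltW.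
  by rewrite -lee_fin fineK ?fin_num_measure// probability_le1.
have qiK : P.-integrable (~` K : set (borel T)) (EFin \o (q \o f)).
  exact: integrableS qi.
apply: (le_trans (le_normr_Rintegral mKC qiK)).
apply: le_trans (ltW (dP _ mKC Kd)).
apply: le_Rintegral => //.
- exact: (integrable_norm qiK).
- apply: (@integrable_norm _ _ _ _ _ (fun x : borel T => complex.Re `|f x|)).
  exact: integrableS fi.
- by move=> x _ /=; rewrite (ger0_norm (rnorm_ge0 (f x))).
Qed.

Lemma weak_integral_exists f : continuous f -> norm_integrable P f ->
  exists v, weak_integral P f v.
Proof.
move=> cf fi.
have /choice[u uP] n : exists v, forall q, real_linear q ->
    (forall x, `|q x| <= rnorm x) ->
    `|q v - \int[P]_(x in [set: borel T]) q (f x)| <= n.+1%:R^-1.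
  by apply: weak_integral_approx => //; rewrite invr_gt0.
(* A functional norming [u m - u n] turns the two approximation errors, together at most $2/(n+1)$,
   into a norm bound. *)
have [n m nm|v vP] := @harmonic_cauchy_lim _ _ u 2.
  have [q [ql qN <-]] := norming_functional (u m - u n).
  have mn : m.+1%:R^-1 <= n.+1%:R^-1 :> R by rewrite lef_pV2 ?posrE// ler_nat.
  have := uP n q ql qN; have := uP m q ql qN; rewrite real_linearB//.
  move: mn; move: (_^-1) (_^-1) (Rintegral _ _ _) => k l I kl.
  by rewrite !ler_norml; lra.
exists v => q ql qN; apply/eqP; rewrite -subr_eq0 -normr_le0.
(* The constant is 2 for the distance from [u n] to the limit plus 1 for the error of [u n]. *)
apply: (@le_harmonic_le0 _ _ 3) => n.
have := vP n; have := uP n q ql qN; have := qN (u n - v); rewrite real_linearB//.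
move: (n.+1%:R^-1) => k.
move: (Rintegral _ _ _) => I.
by rewrite !ler_norml; lra.
Qed.

Lemma weak_integral_unique f v w :
  weak_integral P f v -> weak_integral P f w -> v = w.
Proof.
move=> fv fw; apply/eqP; rewrite -subr_eq0; apply/eqP/rnorm_eq0.
have [q [ql qN <-]] := norming_functional (v - w).
by rewrite real_linearB// fv// fw// subrr.
Qed.

(** Dividing [q] by $|C| + 1$, positive whatever the sign of [C], brings it into the test class. *)
Lemma weak_integral_bounded f v q C : continuous f -> norm_integrable P f ->
  weak_integral P f v -> real_linear q -> (forall x, `|q x| <= C * rnorm x) ->
  q v = \int[P]_(x in [set: borel T]) q (f x).
Proof.
move=> cf fi fv ql qC.
pose D := `|C| + 1; have D0 : 0 < D by rewrite ltr_wpDl.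
have qi := integrable_real_linear cf fi ql qC.
have : D^-1 * q v = \int[P]_(x in [set: borel T]) (D^-1 * q (f x)).
  apply: (fv (fun x => D^-1 * q x)).
    split=> [x y|r x]; first by rewrite ql.1 mulrDr.
    by rewrite ql.2 mulrCA.
  move=> x; rewrite normrM gtr0_norm ?invr_gt0// ler_pdivrMl//.
  rewrite (le_trans (qC x))// ler_wpM2r ?rnorm_ge0//.
  by rewrite (le_trans (ler_norm _))// lerDl.
rewrite RintegralZl// => /mulfI; apply.
by rewrite invr_eq0 gt_eqF.
Qed.

End weak_integral.

(** * Agreement of weak and Bochner integrals *)

Section bochner_weak.
Context {R : realType} {W : completeNormedModType R[i]} {T : ptopologicalType}.
Variable P : probability (borel T) R.
Implicit Types (f : T -> W) (v : W).

Lemma continuous_linear_rnorm_bound (phi : {linear W -> R[i]^o}) :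
  continuous phi -> exists C, forall x, rnorm (phi x) <= C * rnorm x.
Proof.
move=> /(_ 0)/(@continuous_linear_bounded _ _ _ 0)/linear_boundedP.
move=> /pinfty_ex_gt0[r r0 rP]; exists (complex.Re r) => x.
have rE : r = (complex.Re r)%:C by rewrite RRe_real// gtr0_real.
by rewrite -lecR rmorphM/= -!normE -rE.
Qed.

Lemma weak_integral_is_bochner f v : continuous f -> norm_integrable P f ->
  weak_integral P f v -> is_bochner P f v.
Proof.
move=> cf fi fv; split => // phi /continuous_linear_rnorm_bound[C phiC].
have phiZ (r : R) x : phi (r%:C *: x) = r%:C * phi x by rewrite linearZ.
have reL : real_linear (fun x => complex.Re (phi x)).
  split=> [x y|r x]; first by rewrite linearD; case: (phi x) (phi y) => ? ? [].
  by rewrite phiZ; case: (phi x) => a b /=; rewrite mul0r subr0.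
have imL : real_linear (fun x => complex.Im (phi x)).
  split=> [x y|r x]; first by rewrite linearD; case: (phi x) (phi y) => ? ? [].
  by rewrite phiZ; case: (phi x) => a b /=; rewrite mul0r addr0.
have reC x : `|complex.Re (phi x)| <= C * rnorm x.
  exact: le_trans (ler_Re_rnorm _) (phiC x).
have imC x : `|complex.Im (phi x)| <= C * rnorm x.
  apply: le_trans (phiC x); rewrite -(rnormZi (phi x)) -normrN -ReiNIm mulrC.
  exact: ler_Re_rnorm.
split.
  by split; [exact: integrable_real_linear reL reC|exact: integrable_real_linear imL imC].
rewrite /cintegral -(weak_integral_bounded cf fi fv reL reC).
rewrite -(weak_integral_bounded cf fi fv imL imC).
by case: (phi v).
Qed.

(* A real functional [q] is the real part of [x |-> q x - i q (i x)]. *)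
Lemma is_bochner_weak_integral f v : is_bochner P f v -> weak_integral P f v.
Proof.
move=> [fi fv] q ql qN.
pose phi x : R[i]^o := q x +i* (- q ('i *: x)).
have phi_lin : linear phi.
  move=> [a b] x y; rewrite /phi.
  have -> : (a +i* b) *: x = a%:C *: x + b%:C *: ('i *: x).
    rewrite scalerA -scalerDl; congr (_ *: _).
    by apply/eqP; rewrite eq_complex/= !mul0r !mulr0 !mulr1 !subr0 !addr0 add0r !eqxx.
  have -> : 'i *: (a%:C *: x + b%:C *: ('i *: x) + y) =
      a%:C *: ('i *: x) - b%:C *: x + 'i *: y.
    rewrite !scalerDr; congr (_ + _ + _); first by rewrite !scalerA mulrC.
    by rewrite !scalerA mulrAC -expr2 sqr_i mulN1r scaleNr.
  rewrite !ql.1 -scaleNr -rmorphN !ql.2 /=.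
  by apply/eqP; rewrite eq_complex/=; apply/andP; split; apply/eqP; ring.
pose phiL : {linear W -> R[i]^o} :=
  HB.pack phi (GRing.isLinear.Build _ _ _ _ phi phi_lin).
have phi_cont : continuous phiL.
  apply/linear_bounded_continuous/linear_boundedP.
  (* The bound is $|\varphi(x)| \le |q(x)| + |q(ix)| \le 2\|x\|$. *)
  exists 2; split; first exact: realn.
  move=> r r2 x; rewrite (le_trans _ (ler_wpM2r (normr_ge0 _) (ltW r2)))//.
  rewrite [`|x|]normE [`|phiL x|]normE -(rmorph_nat (real_complex R)) -rmorphM lecR.
  have -> : phiL x = (q x)%:C - 'i * (q ('i *: x))%:C.
    by apply/eqP; rewrite eq_complex/=; apply/andP; split; apply/eqP; ring.
  rewrite (le_trans (ler_rnormB (W := R[i]^o) _ _))//.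
  rewrite (rnormZi (W := R[i]^o) (q ('i *: x))%:C) !rnormR mulr2n mulrDl mul1r.
  by rewrite lerD// (le_trans (qN _))// rnormZi.
have [_ /eqP] := fv phiL phi_cont.
by rewrite eq_complex /= => /andP[/eqP].
Qed.

(** Whatever [xget] selects is a weak integral, and functionals separate points. *)
Lemma bochnerE f v : continuous f -> norm_integrable P f ->
  weak_integral P f v -> bochner P f = v.
Proof.
move=> cf fi fv; rewrite /bochner.
case: xgetP => [w _ /is_bochner_weak_integral fw|/(_ v) []].
  exact: weak_integral_unique fw fv.
exact: weak_integral_is_bochner.
Qed.

End bochner_weak.

(** * The variance identity *)

Lemma continuous_csmul_star {R : realType} {V : cstarAlgType R}
    {T : topologicalType} (f : T -> V) :
  continuous f -> continuous (fun t => csmul (csstar (f t)) (f t)).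
Proof.
move=> cf t; apply/cvgrPdist_lt => e e0.
have eE : e = (complex.Re e)%:C by rewrite RRe_real// gtr0_real.
have Re0 : 0 < complex.Re e by rewrite -ltcR -eE.
(* [N] bounds $\|f(t)\| + \|f(s)\|$ as soon as $\|f(t) - f(s)\| < 1$. *)
pose N := 2 * rnorm (f t) + 1.
have N0 : 0 < N by rewrite /N; have := rnorm_ge0 (f t); lra.
have d0 : 0 < Num.min 1 (complex.Re e / N) by rewrite lt_min ltr01 divr_gt0.
have d0C : 0 < (Num.min 1 (complex.Re e / N))%:C by rewrite ltcR.
have /cvgrPdist_lt/(_ _ d0C) := cf t.
apply: filterS => s; rewrite !normE eE !ltcR lt_min => /andP[ts1 tsN].
have -> : csmul (csstar (f t)) (f t) - csmul (csstar (f s)) (f s) =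
    csmul (csstar (f t)) (f t - f s) + csmul (csstar (f t - f s)) (f s).
  by cs_expand; lmod_start (R[i]) V; ring.
apply: (le_lt_trans (ler_rnormD _ _)).
have h1 := ler_rnormM (csstar (f t)) (f t - f s).
have h2 := ler_rnormM (csstar (f t - f s)) (f s).
rewrite !rnorm_star in h1 h2.
have h3 : rnorm (f s) <= rnorm (f t) + 1.
  have -> : f s = f t - (f t - f s) by rewrite opprB addrC subrK.
  by rewrite (le_trans (ler_rnormB _ _))// lerD2l ltW.
rewrite ltr_pdivlMr// in tsN.
apply: le_lt_trans tsN.
have := ler_wpM2l (rnorm_ge0 (f t - f s)) h3; rewrite /N; lra.
Qed.

Local Close Scope complex_scope.
Unset Implicit Arguments.
Set Strict Implicit.
Set Printing Implicit Defensive.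

Theorem theorem2p1 (R : realType) (V : cstarAlgType R) (T : ptopologicalType)
    (T_lc : locally_compact [set: T]) (T_hausdorff : hausdorff_space T)
    (P : probability (borel T) R) (P_radon : radon P)
    (A : T -> V) (A_cont : continuous A)
    (A_int : norm_integrable P A)
    (A2_int : norm_integrable P (fun t => cssqr (csabs (A t)))) :
  bochner P (fun t => cssqr (csabs (A t - bochner P (fun s => A s)))) =
  bochner P (fun t => cssqr (csabs (A t))) -
  cssqr (csabs (bochner P (fun t => A t))).
Proof.
have sqE (B : T -> V) : (fun t => cssqr (csabs (B t))) =
    (fun t => csmul (csstar (B t)) (B t)).
  by apply/funext => t; rewrite cssqr_csabs.
have [m Am] := weak_integral_exists T_hausdorff P_radon A_cont A_int.
rewrite (bochnerE A_cont A_int Am) cssqr_csabs !sqE.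
rewrite sqE in A2_int.
have A2_cont := continuous_csmul_star A_cont.
have [w A2w] := weak_integral_exists T_hausdorff P_radon A2_cont A2_int.
rewrite (bochnerE A2_cont A2_int A2w).
have B_cont : continuous (fun t => A t - m).
  by move=> t; apply: continuousB; [exact: A_cont|exact: cvg_cst].
have B2_cont := continuous_csmul_star B_cont.
apply: bochnerE => //.
  (* Domination by $\|A_t - m\|^2 \le 2\|A_t\|^2 + 2\|m\|^2$. *)
  pose g (t : borel T) : \bar R := ((2%:E * (rnorm (csmul (csstar (A t)) (A t)))%:E)
    + (2 * rnorm m ^+ 2)%:E)%E.
  apply: (@le_integrable _ (borel T) R P setT measurableT _ g).
  - apply/measurable_EFinP; apply: continuous_borel_measurable => t.
    exact: (@continuous_comp _ _ _ _ (@rnorm R V) t (B2_cont t)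
      (@continuous_rnorm R V _)).
  - move=> t _; rewrite /g -EFinM -EFinD lee_fin.
    rewrite (ger0_norm (rnorm_ge0 _)) (le_trans _ (ler_norm _))//.
    rewrite !rnorm_star_sqr.
    have := ler_rnormB (A t) m; have := rnorm_ge0 (A t - m).
    have := sqr_ge0 (rnorm (A t) - rnorm m).
    move: (rnorm (A t)) (rnorm m) (rnorm (A t - m)) => a b c; nra.
  - apply: (integrableD measurableT).
      exact: (integrableZl measurableT _ A2_int).
    exact: finite_measure_integrable_cst.
move=> q ql qN.
(* The cross term of the expanded square; the star makes it linear over the reals only. *)
pose q3 x := q (csmul (csstar m) x + csmul (csstar x) m).
have q3l : real_linear q3.
  split=> [x y|r x]; rewrite /q3.
    by rewrite -ql.1; congr q; cs_ring R V.
  by rewrite -ql.2; congr q; cs_ring R V.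
have q3N x : `|q3 x| <= 2 * rnorm m * rnorm x.
  rewrite (le_trans (qN _))// (le_trans (ler_rnormD _ _))//.
  have := ler_rnormM (csstar m) x; have := ler_rnormM (csstar x) m.
  by rewrite !rnorm_star; lra.
have i1 : P.-integrable [set: borel T]
    (EFin \o (fun t => q (csmul (csstar (A t)) (A t)))).
  by apply: (integrable_real_linear (C := 1) A2_cont) => // x; rewrite mul1r.
have i2 : P.-integrable [set: borel T] (EFin \o (fun t => q3 (A t))).
  exact: (integrable_real_linear A_cont A_int q3l q3N).
pose k := q (csmul (csstar m) m).
have i3 : P.-integrable [set: borel T] (EFin \o (fun=> k)).
  exact: finite_measure_integrable_cst.
have -> : \int[P]_(t in [set: borel T]) q (csmul (csstar (A t - m)) (A t - m)) =
    \int[P]_(t in [set: borel T])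
      (q (csmul (csstar (A t)) (A t)) - (q3 (A t) - k)).
  apply: eq_Rintegral => t _; rewrite /q3 /k -!real_linearB//; congr q.
  by cs_ring R V.
rewrite RintegralB//; last exact: (integrableB measurableT i2 i3).
have P1 : fine (P [set: borel T]) = 1 by rewrite probability_setT.
rewrite RintegralB// Rintegral_cst// [fine _]P1 mulr1.
(* The cross term integrates to [q3 m], which is [k + k], so that [q3 m - k] leaves exactly [k]. *)
rewrite -(weak_integral_bounded A_cont A_int Am q3l q3N) -(A2w q ql qN).
by rewrite real_linearB// /q3 ql.1 -/k addrK.
Qed.
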